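(* Let $\bar R\in(0,\infty)$ and assume that $p,q\in[1,\infty]$ and $\frac{d_0}p+\frac1q=1$. Then for any $R\in(0,\bar R]$, $x\in\mathbb{R}^d$, and Borel nonnegative $f$ given on $C_R$, we have $$E\int_0^{\tau_R(x)}f(t,x+x_t)\,dt\le NR^{(2d_0-d)/p}\|f\|_{L_{p,q}(C_R)},$$ where $N=N(\delta,d,\underline R,p,p_0,\bar b_{\bar R},\bar R)$.
   Context: Let $d\ge2$, $\delta\in(0,1)$, $p_0,q_0\in[1,\infty)$ with $d/p_0+1/q_0=1$; $\mathbb{S}_\delta$ is the set of symmetric $d\times d$ matrices with eigenvalues in $[\delta,\delta^{-1}]$. Sets: $B_R=\{x\in\mathbb{R}^d:|x|<R\}$, $C_{T,R}=[0,T)\times B_R$, $C_R(t,x)=(t,x)+C_{R^2,R}$, $C_R=C_R(0,0)$, $\mathbb{R}^{d+1}_+=[0,\infty)\times\mathbb{R}^d$. Mixed norms: for $p,q\in[1,\infty]$ and a domain $Q\subset\mathbb{R}^{d+1}=\{(t,x)\}$ (or $Q=C_R$), $\|f\|^q_{L_{p,q}(Q)}=\int_{\mathbb{R}}\big(\int_{\mathbb{R}^d}I_Q|f(t,x)|^p\,dx\big)^{q/p}dt$ if $p\ge q$, and $\|f\|^p_{L_{p,q}(Q)}=\int_{\mathbb{R}^d}\big(\int_{\mathbb{R}}I_Q|f(t,x)|^q\,dt\big)^{p/q}dx$ if $p\le q$, with the natural interpretation (essential suprema) if $p=\infty$ or $q=\infty$. Process: $(\Omega,\mathcal{F},P)$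 is a complete probability space, $\mathcal{F}_t$, $t\ge0$, an increasing family of complete $\sigma$-fields, $w_t$ an $\mathbb{R}^d$-valued Wiener process relative to $\mathcal{F}_t$, $\sigma_t$ an $\mathbb{S}_\delta$-valued $\mathcal{F}_t$-adapted process, $b_t$ an $\mathbb{R}^d$-valued $\mathcal{F}_t$-adapted process with $\int_0^T|b_t|dt<\infty$ for all $T$ and $\omega$, and $x_t=\int_0^t\sigma_s\,dw_s+\int_0^tb_s\,ds$. Standing assumption (A): there are a (Borel, nonnegative) function $h\in L_{p_0,q_0,\mathrm{loc}}$ on $\mathbb{R}^{d+1}$ with $|b_t|\le h(t,x_t)$, and a bounded nondecreasing function $\bar b_R$, $R\in(0,\infty)$, with $\|h\|^{q_0}_{L_{p_0,q_0}(C_R(t,x))}\le\bar b_RR$ for all $(t,x)\in\mathbb{R}^{d+1}$, $R\in(0,\infty)$. Exit times: $\tau_{T,R}(x)=\inf\{t\ge0:(t,x+x_t)\notin C_{T,R}\}$, $\tau_R(x)=\tau_{R^2,R}(x)$, $\tau_R=\tau_R(0)$, $\tau'_R(x)=\inf\{t\ge0:x+x_t\notin B_R\}$, $\gamma_R(x)=\inf\{t\ge0:x+x_t\in\bar B_R\}$. Constants $\bar\xi,\bar N,\underline R$: $\bar\xi=\bar\xi(d,\delta)\in(0,1)$ and $\bar N=\bar N(d,p_0,\delta)$ are fixed constants (they exist), continuous in $\delta$, such that for every process satisfying (A) and every $R$ with $\bar N\bar b_R\le1$: for $|x|\le R$, $n\ge1$, $P(\tau_R(x)=R^2)\le1-\bar\xi$,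 $P(\tau_R=R^2)\ge\bar\xi$, $P(\tau'_R(x)\ge nR^2)\le(1-\bar\xi)^n$, $E\tau'_R(x)\le N(d,\delta)R^2$, $E\int_0^{\tau'_R(x)}h(t,x_t)dt\le N(d,p_0,\delta)(1+\bar b_R)^{d/p_0}\bar b_R^{1/q_0}R$; and $P(\tau'_R(x)>\gamma_{R/16}(x))\ge\bar\xi$ for $|x|\le 9R/16$. Standing assumption (B): there is $\underline R\in(0,\infty)$, fixed, with $\bar N\bar b_{\underline R}<1$. The number $d_0$: for $\lambda>0$ let $G_\lambda\ge0$ (Borel on $\mathbb{R}^{d+1}$, zero for $t\le0$) and $g_\lambda\ge0$ (Borel on $\mathbb{R}^d$) be the Green's functions: $E\int_0^\infty e^{-\lambda t}f(t,x_t)dt=\int fG_\lambda\,dxdt$ and $E\int_0^\infty e^{-\lambda t}f(x_t)dt=\int fg_\lambda\,dx$ for Borel $f\ge0$ (they exist). $d_0\in(1,d)$, $d_0>d/2$, is a fixed number (it exists) depending only on $\delta,d,\underline R,p_0$ such that, for all processes $x_t=\int_0^t\sigma_s\,dw_s+\int_0^tb_s\,ds$ with $\sigma_t$ an $\mathbb{S}_\delta$-valued adapted process and $b_t$ an adapted process satisfying (A) and (B) with the given $\delta,d,\underline R,p_0$, and all $\lambda>0$: $\|G_\lambda\|_{L_{p/(p-1)}(\mathbb{R}^{d+1}_+)}\le N(\delta,d,\underline R,p_0,p)\,\ddot\lambda_p^{(d+2)/(2p)-1}$ for $p\ge d_0+1$, and $\|g_\lambda\|_{L_{p/(p-1)}(\mathbb{R}^d)}\le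 N(\delta,d,\underline R,p_0,p)\,\ddot\lambda_{e,p}^{d/(2p)-1}$ for $p\ge d_0$, where $\ddot\lambda_p=\lambda(1\wedge\lambda)^{d/(2p-d-2)}$ and $\ddot\lambda_{e,p}=\lambda(1\wedge\lambda)^{d/(2p-d)}$. $N(\cdots)$ denotes a constant depending only on the listed arguments. *)

(* Defs.v *)
From HB Require Import structures.
From mathcomp Require Import all_boot all_order all_algebra.
From mathcomp Require Import all_classical all_reals all_analysis.

Set Implicit Arguments.
Unset Strict Implicit.
Unset Printing Implicit Defensive.

Import Order.TTheory GRing.Theory Num.Theory.
Import numFieldNormedType.Exports.

Local Open Scope classical_set_scope.
Local Open Scope ring_scope.

(* The sigma-algebra on m x n matrices generated by the entries; on R^d,
   rendered as 'cV[R]_d, this is the Borel sigma-algebra. *)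
Definition entry_preimages (R : realType) (m n : nat) :
    set (set 'M[R]_(m, n)) :=
  [set E | exists i j, exists2 B : set R,
    measurable B & E = [set A : 'M[R]_(m, n) | B (A i j)]].

Definition measure_matrix_display : measure_display.
Proof. exact: default_measure_display. Qed.

HB.instance Definition _ (R : realType) (m n : nat) :=
  @isMeasurable.Build measure_matrix_display 'M[R]_(m, n)
    <<s @entry_preimages R m n >>
    (@sigma_algebra0 _ setT _) (@sigma_algebraC _ _)
    (@sigma_algebra_bigcup _ setT _).

Lemma measurable_entry (R : realType) m n (i : 'I_m) (j : 'I_n) :
  measurable_fun setT (fun A : 'M[R]_(m, n) => A i j).
Proof.
move=> _ B mB; rewrite setTI; apply: sub_sigma_algebra.
by exists i, j, B.
Qed.

Lemma measurable_fun_mx (R : realType) d (T : measurableType d) m n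
    (f : T -> 'M[R]_(m, n)) :
  (forall i j, measurable_fun setT (fun t => f t i j)) ->
  measurable_fun setT f.
Proof.
move=> mf; apply: (@measurability _ _ _ _ _ _ (@entry_preimages R m n)) => //.
by move=> _ [_ [i [j [B mB ->]]] <-]; exact: mf.
Qed.

Lemma product_measure_sigma_finite (R : realType) d1 d2
    (T1 : measurableType d1) (T2 : measurableType d2)
    (m1 : {sigma_finite_measure set T1 -> \bar R})
    (m2 : {sigma_finite_measure set T2 -> \bar R}) :
  sigma_finite setT (m1 \x m2)%E.
Proof.
have /sigma_finiteP[F [TF ndF Foo]] := sigma_finiteT m1.
have /sigma_finiteP[G [TG ndG Goo]] := sigma_finiteT m2.
exists (fun n => F n `*` G n).
  rewrite -setXTT TF TG predeqE => -[x y]; split.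
    move=> [/= [n _ Fnx] [k _ Gky]]; exists (maxn n k) => //; split.
    - by move: x Fnx; exact/subsetPset/ndF/leq_maxl.
    - by move: y Gky; exact/subsetPset/ndG/leq_maxr.
  by move=> [n _ []/= ? ?]; split; exists n.
move=> k; have [? ?] := Foo k; have [? ?] := Goo k.
split; first exact: measurableX.
by rewrite product_measure1E// lte_mul_pinfty// ge0_fin_numE.
Qed.

Section lebesgue_vec_succ.
Context (R : realType) (n : nat).
Variable mu : {sigma_finite_measure set 'cV[R]_n -> \bar R}.

Definition vcons (z : measurableTypeR R * 'cV[R]_n) : 'cV[R]_n.+1 :=
  \col_i (if unlift ord0 i is Some j then z.2 j ord0 else z.1).

Definition vuncons (v : 'cV[R]_n.+1) : measurableTypeR R * 'cV[R]_n :=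
  (v ord0 ord0, \col_i v (lift ord0 i) ord0).

Lemma vconsK : cancel vcons vuncons.
Proof.
move=> [a v]; rewrite /vuncons /vcons !mxE unlift_none; congr (_, _).
by apply/colP => i; rewrite !mxE liftK.
Qed.

Lemma measurable_vcons : measurable_fun setT vcons.
Proof.
apply: measurable_fun_mx => i j; under eq_fun do rewrite mxE.
case: unliftP => [k|] _; last exact: measurable_fst.
exact: (measurableT_comp (measurable_entry k ord0) measurable_snd).
Qed.

Lemma measurable_vuncons : measurable_fun setT vuncons.
Proof.
apply/measurable_fun_pairP; split; first exact: measurable_entry.
apply: measurable_fun_mx => i j /=; rewrite /comp /=.
by under eq_fun do rewrite mxE; exact: measurable_entry.
Qed.

Definition lebesgue_vec_succ :=
  pushforward (@lebesgue_measure R \x mu)%E vcons.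

Let lebesgue_vec_succ0 : lebesgue_vec_succ set0 = 0%E.
Proof. by rewrite /lebesgue_vec_succ /pushforward preimage_set0 measure0. Qed.

Let lebesgue_vec_succ_ge0 A : (0 <= lebesgue_vec_succ A)%E.
Proof. by rewrite /lebesgue_vec_succ /pushforward measure_ge0. Qed.

Let lebesgue_vec_succ_sigma_additive : semi_sigma_additive lebesgue_vec_succ.
Proof.
have mvcons A : measurable A -> measurable (vcons @^-1` A).
  by move=> mA; rewrite -[X in measurable X]setTI; exact: measurable_vcons.
move=> F mF tF mUF; rewrite /lebesgue_vec_succ /pushforward preimage_bigcup.
apply: measure_semi_sigma_additive => [n'||]; first exact: mvcons.
- apply/trivIsetP => /= i j _ _ ij; rewrite -preimage_setI.
  by move/trivIsetP : tF => /(_ _ _ _ _ ij) ->//; rewrite preimage_set0.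
- by rewrite -preimage_bigcup; exact: mvcons.
Qed.

HB.instance Definition _ := isMeasure.Build _ _ _ lebesgue_vec_succ
  lebesgue_vec_succ0 lebesgue_vec_succ_ge0 lebesgue_vec_succ_sigma_additive.

Lemma lebesgue_vec_succ_sigma_finite : sigma_finite setT lebesgue_vec_succ.
Proof.
have [F FT mF] : sigma_finite setT (@lebesgue_measure R \x mu)%E.
  exact: product_measure_sigma_finite.
exists (fun k => vuncons @^-1` F k).
  by rewrite -preimage_bigcup -FT preimage_setT.
move=> k; have [mFk Fk] := mF k; split.
  by rewrite -[X in measurable X]setTI; exact: measurable_vuncons.
rewrite /lebesgue_vec_succ /pushforward -comp_preimage.
by rewrite (_ : vuncons \o vcons = id) //; apply/funext => z /=; exact: vconsK.
Qed.

HB.instance Definition _ := @Measure_isSigmaFinite.Build _ _ _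
  lebesgue_vec_succ lebesgue_vec_succ_sigma_finite.

End lebesgue_vec_succ.

Fixpoint lebesgue_vec (R : realType) (n : nat) :
    {sigma_finite_measure set 'cV[R]_n -> \bar R} :=
  if n is n'.+1 then lebesgue_vec_succ (lebesgue_vec R n')
  else \d_(0 : 'cV[R]_0).

(* This identity characterizes lebesgue_vec. *)
Lemma lebesgue_vec_box (R : realType) (n : nat) (B : 'I_n -> set R) :
  (forall i, measurable (B i)) ->
  lebesgue_vec R n [set v | forall i, B i (v i ord0)] =
  (\prod_(i < n) lebesgue_measure (B i))%E.
Proof.
elim: n B => [|n IHn] B mB.
  by rewrite big_ord0 /= diracE mem_set // => -[].
rewrite big_ord_recl -IHn //= /lebesgue_vec_succ /pushforward.
pose V := [set v : 'cV[R]_n | forall i, B (lift ord0 i) (v i ord0)].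
have mV : measurable V.
  rewrite (_ : V = \bigcap_(i in [set: 'I_n])
      ((fun v : 'cV[R]_n => v i ord0) @^-1` B (lift ord0 i))).
    apply: fin_bigcap_measurable => // i _.
    by rewrite -[X in measurable X]setTI; exact: measurable_entry.
  by apply/seteqP; split=> [v /= vB i _|v /= vB i]; exact: vB.
apply: (eq_trans _ (@product_measure1E _ _ _ _ R
  (@lebesgue_measure R) (lebesgue_vec R n) _ _ (mB ord0) mV)).
congr (product_measure1 _ _ _); apply/seteqP; split=> -[a v] /=.
  move=> avB; split=> [|i].
    by have := avB ord0; rewrite mxE unlift_none.
  by have := avB (lift ord0 i); rewrite mxE liftK.
move=> [aB vB] i; rewrite mxE.
by case: unliftP => [j|] ->.
Qed.

(* The Euclidean norm; the library norm on matrices is the sup norm. *)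
Definition enorm (R : realType) (m n : nat) (A : 'M[R]_(m, n)) : R :=
  Num.sqrt (\sum_i \sum_j A i j ^+ 2).

Definition spd_matrices (R : realType) (d : nat) (delta : R) : set 'M[R]_d :=
  [set A | A^T = A /\ forall a, eigenvalue A a -> delta <= a <= delta^-1].

Section cylinders.
Context (R : realType) (d : nat).

Definition cylinder (T r : R) : set (R * 'cV[R]_d) :=
  [set z | 0 <= z.1 < T /\ enorm z.2 < r].

(* C_r(t, x) = (t, x) + C_{r^2, r} *)
Definition parabolic_cylinder (r t : R) (x : 'cV[R]_d) : set (R * 'cV[R]_d) :=
  [set z | cylinder (r ^+ 2) r (z.1 - t, z.2 - x)].

(* L_{p,q}(Q): the larger exponent is integrated first, p being attached to x
   and q to t; for p = q the two orders agree by Tonelli's theorem. *)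
Definition mixed_norm (p q : \bar R) (Q : set (R * 'cV[R]_d))
    (f : R * 'cV[R]_d -> R) : \bar R :=
  let g t x := (if (t, x) \in Q then f (t, x) else 0)%:E in
  if (q <= p)%E then
    Lnorm (@lebesgue_measure R) q (fun t => Lnorm (lebesgue_vec R d) p (g t))
  else
    Lnorm (lebesgue_vec R d) p
      (fun x => Lnorm (@lebesgue_measure R) q (g ^~ x)).

End cylinders.

Section stochastic_integral.
Context (R : realType) (disp : measure_display) (Omega : measurableType disp).
Variables (P : probability Omega R) (F : R -> set (set Omega)) (d : nat).

Definition complete_filtration : Prop :=
  [/\ forall t : R, 0 <= t -> sigma_algebra setT (F t),
      forall t : R, 0 <= t -> F t `<=` measurable,
      forall s t : R, 0 <= s -> s <= t -> F s `<=` F t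
    & forall t : R, 0 <= t -> P.-negligible `<=` F t].

Definition adapted (m n : nat) (Y : R -> Omega -> 'M[R]_(m, n)) : Prop :=
  forall t : R, 0 <= t -> forall B, measurable B -> F t (Y t @^-1` B).

Definition measurable_adapted (m n : nat) (Y : R -> Omega -> 'M[R]_(m, n)) :
    Prop :=
  adapted Y /\
  measurable_fun ([set t : R | 0 <= t] `*` [set: Omega])
    (fun z : R * Omega => Y z.1 z.2).

Definition continuous_paths (m n : nat) (Y : R -> Omega -> 'M[R]_(m, n)) :
    Prop :=
  forall omega, {within [set t : R | 0 <= t], continuous (Y ^~ omega)}.

(* The last clause says that, for s < t, w_t - w_s is independent of F_s with
   law N(0, (t - s) I); normal_prob takes the standard deviation. *)
Definition wiener_process (w : R -> Omega -> 'cV[R]_d) : Prop :=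
  [/\ forall omega, w 0 omega = 0,
      continuous_paths w,
      adapted w
    & forall s t : R, 0 <= s -> s < t -> forall A, F s A ->
        forall B : 'I_d -> set R, (forall i, measurable (B i)) ->
        (P (A `&` [set omega | forall i, B i ((w t omega - w s omega)%R i ord0)])
         = P A * \prod_(i < d) normal_prob 0 (Num.sqrt (t - s)) (B i))%E].

Record simple_integrand := SimpleIntegrand {
  si_size : nat;
  si_time : nat -> R;
  si_coef : nat -> Omega -> 'M[R]_d;
  si_time_ge0 : 0 <= si_time 0%N;
  si_time_le : forall k, si_time k <= si_time k.+1;
  si_coef_adapted : forall k B, measurable B ->
    F (si_time k) (si_coef k @^-1` B);
  si_coef_bounded : exists M : R, forall k omega, enorm (si_coef k omega) <= M }.

Definition si_eval (H : simple_integrand) (t : R) (omega : Omega) : 'M[R]_d :=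
  \sum_(k < si_size H)
    (if si_time H k < t <= si_time H k.+1 then si_coef H k omega else 0).

Definition si_integral (w : R -> Omega -> 'cV[R]_d) (H : simple_integrand)
    (t : R) (omega : Omega) : 'cV[R]_d :=
  \sum_(k < si_size H) si_coef H k omega *m
    (w (Num.min t (si_time H k.+1)) omega - w (Num.min t (si_time H k)) omega).

(* M is a continuous version of the Ito integral of sigma with respect to w:
   the L^2 limit of the integrals of simple processes approximating sigma. *)
Definition ito_integral (w : R -> Omega -> 'cV[R]_d)
    (sigma : R -> Omega -> 'M[R]_d) (M : R -> Omega -> 'cV[R]_d) : Prop :=
  [/\ adapted M, continuous_paths M &
    exists H : nat -> simple_integrand, forall T : R, 0 <= T ->
      (\int[P]_omega \int[@lebesgue_measure R]_(s in `[0%R, T])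
         (enorm (sigma s omega - si_eval (H n) s omega) ^+ 2)%R%:E)%E
        @[n --> \oo] --> 0%E /\
      (\int[P]_omega
         (enorm (M T omega - si_integral w (H n) T omega) ^+ 2)%R%:E)%E
        @[n --> \oo] --> 0%E].

End stochastic_integral.

(* A process x_t = int_0^t sigma_s dw_s + int_0^t b_s ds together with the
   filtered probability space carrying it. Adapted integrands are taken
   jointly measurable in (t, omega), so that the integrals make sense. *)
Record ito_process (R : realType) (d : nat) (delta : R) := ItoProcess {
  ip_disp : measure_display;
  ip_omega : measurableType ip_disp;
  ip_prob : probability ip_omega R;
  ip_filtration : R -> set (set ip_omega);
  ip_wiener : R -> ip_omega -> 'cV[R]_d;
  ip_sigma : R -> ip_omega -> 'M[R]_d;
  ip_drift : R -> ip_omega -> 'cV[R]_d;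
  ip_stoch : R -> ip_omega -> 'cV[R]_d;
  ip_prob_complete : measure_is_complete ip_prob;
  ip_filtrationP : complete_filtration ip_prob ip_filtration;
  ip_wienerP : wiener_process ip_prob ip_filtration ip_wiener;
  ip_sigma_adapted : measurable_adapted ip_filtration ip_sigma;
  ip_sigmaP : forall (t : R) omega, 0 <= t ->
    spd_matrices delta (ip_sigma t omega);
  ip_drift_adapted : measurable_adapted ip_filtration ip_drift;
  ip_driftP : forall (T : R) omega, 0 <= T ->
    (\int[@lebesgue_measure R]_(s in `[0%R, T])
       (enorm (ip_drift s omega))%:E < +oo)%E;
  ip_stochP : ito_integral ip_prob ip_filtration ip_wiener ip_sigma ip_stoch }.

Section process.
Context (R : realType) (d : nat) (delta : R) (X : ito_process d delta).

Local Notation Omega := (ip_omega X).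
Local Notation P := (ip_prob X).

Definition ip_path (t : R) (omega : Omega) : 'cV[R]_d :=
  ip_stoch t omega +
  \col_i \int[@lebesgue_measure R]_(s in `[0, t]) ip_drift s omega i ord0.

(* tau_{T,r}(x), tau_r(x), tau'_r(x) and gamma_r(x), with inf of the empty set
   equal to +oo. *)
Definition tau_cyl (T r : R) (x : 'cV[R]_d) (omega : Omega) : \bar R :=
  ereal_inf [set t%:E | t in
    [set t | 0 <= t /\ ~ cylinder T r (t, x + ip_path t omega)]].

Definition tau (r : R) (x : 'cV[R]_d) (omega : Omega) : \bar R :=
  tau_cyl (r ^+ 2) r x omega.

Definition tau_ball (r : R) (x : 'cV[R]_d) (omega : Omega) : \bar R :=
  ereal_inf [set t%:E | t in
    [set t | 0 <= t /\ ~ (enorm (x + ip_path t omega) < r)]].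

Definition gamma_ball (r : R) (x : 'cV[R]_d) (omega : Omega) : \bar R :=
  ereal_inf [set t%:E | t in
    [set t | 0 <= t /\ enorm (x + ip_path t omega) <= r]].

(* E int_0^T Y_t dt for a random time T *)
Definition expect_int (T : Omega -> \bar R) (Y : R -> Omega -> R) : \bar R :=
  (\int[P]_omega
     \int[@lebesgue_measure R]_(t in [set t : R | (0 <= t)%R /\ t%:E < T omega])
       (Y t omega)%:E)%E.

(* The drift is dominated by h, which satisfies a Morrey condition with growth
   function bbar. *)
Definition morrey_drift (p0 q0 : R) (h : R * 'cV[R]_d -> R) (bbar : R -> R) :
    Prop :=
  [/\ measurable_fun setT h /\ forall z, 0 <= h z,
      forall (t : R) x (r : R), 0 < r ->
        (mixed_norm p0%:E q0%:E (parabolic_cylinder r t x) h < +oo)%E,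
      forall (t : R) omega, 0 <= t ->
        enorm (ip_drift t omega) <= h (t, ip_path t omega),
      (exists M : R, forall r : R, 0 < r -> `|bbar r| <= M) /\
      (forall r s : R, 0 < r -> r <= s -> bbar r <= bbar s)
    & forall (t : R) x (r : R), 0 < r ->
        (mixed_norm p0%:E q0%:E (parabolic_cylinder r t x) h `^ q0
         <= (bbar r * r)%:E)%E].

Definition parabolic_green (lam : R) (G : R * 'cV[R]_d -> R) : Prop :=
  [/\ measurable_fun setT G,
      forall z, 0 <= G z,
      forall z, z.1 <= 0 -> G z = 0
    & forall f : R * 'cV[R]_d -> R,
        measurable_fun setT f -> (forall z, 0 <= f z) ->
        expect_int (fun=> +oo%E)
          (fun t omega => expR (- lam * t) * f (t, ip_path t omega)) =
        (\int[@lebesgue_measure R \x lebesgue_vec R d]_z (f z * G z)%:E)%E].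

Definition elliptic_green (lam : R) (g : 'cV[R]_d -> R) : Prop :=
  [/\ measurable_fun setT g,
      forall x, 0 <= g x
    & forall f : 'cV[R]_d -> R,
        measurable_fun setT f -> (forall x, 0 <= f x) ->
        expect_int (fun=> +oo%E)
          (fun t omega => expR (- lam * t) * f (ip_path t omega)) =
        (\int[lebesgue_vec R d]_x (f x * g x)%:E)%E].

End process.

Arguments tau_cyl {R d delta} X.
Arguments tau {R d delta} X.
Arguments tau_ball {R d delta} X.
Arguments gamma_ball {R d delta} X.
Arguments expect_int {R d delta X}.

Section constants.
Context (R : realType).

Definition admissible (d : nat) (delta p0 q0 : R) : Prop :=
  [/\ (2 <= d)%N, 0 < delta < 1, 1 <= p0, 1 <= q0 & d%:R / p0 + q0^-1 = 1].

(* The defining properties of the constants xibar(d, delta) and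
   Nbar(d, p0, delta). *)
Definition exit_constants (xibar : nat -> R -> R) (Nbar : nat -> R -> R -> R) :
    Prop :=
  (forall (d : nat) (delta p0 q0 : R), admissible d delta p0 q0 ->
     [/\ 0 < xibar d delta < 1,
         {within `]0, 1[, continuous (xibar d)}
       & {within `]0, 1[, continuous (Nbar d p0)}]) /\
  exists (N1 : nat -> R -> R) (N2 : nat -> R -> R -> R),
  forall (d : nat) (delta p0 q0 : R), admissible d delta p0 q0 ->
  forall (X : ito_process d delta) h bbar, morrey_drift X p0 q0 h bbar ->
  forall r : R, 0 < r -> Nbar d p0 delta * bbar r <= 1 ->
  let P := ip_prob X in
  let xi := xibar d delta in
  [/\ (xi%:E <= P [set omega | tau X r 0 omega = (r ^+ 2)%:E])%E,
      forall x, enorm x <= r ->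
        [/\ (P [set omega | tau X r x omega = (r ^+ 2)%:E] <= (1 - xi)%:E)%E,
            forall n, (1 <= n)%N ->
              (P [set omega | ((n%:R * r ^+ 2)%R%:E <= tau_ball X r x omega)%E]
               <= ((1 - xi) ^+ n)%:E)%E,
            (\int[P]_omega tau_ball X r x omega <= (N1 d delta * r ^+ 2)%:E)%E
          & (expect_int (tau_ball X r x) (fun t omega => h (t, ip_path t omega))
             <= (N2 d p0 delta * (1 + bbar r) `^ (d%:R / p0)
                 * bbar r `^ (q0^-1) * r)%:E)%E]
    & forall x, enorm x <= 9%:R * r / 16%:R ->
        (xi%:E <= P [set omega |
           (gamma_ball X (r / 16%:R) x omega < tau_ball X r x omega)%E])%E].

(* The defining properties of d0 = d0(delta, d, Rlow, p0), including the
   existence of the Green's functions to which they refer. *)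
Definition green_exponent (Nbar : nat -> R -> R -> R)
    (d0 : R -> nat -> R -> R -> R) : Prop :=
  exists NG Ng : R -> nat -> R -> R -> R -> R,
  forall (d : nat) (delta p0 q0 Rlow : R), admissible d delta p0 q0 -> 0 < Rlow ->
  let d0' := d0 delta d Rlow p0 in
  [/\ 1 < d0' < d%:R, d%:R / 2 < d0' &
    forall (X : ito_process d delta) h bbar, morrey_drift X p0 q0 h bbar ->
    Nbar d p0 delta * bbar Rlow < 1 ->
    forall lam : R, 0 < lam ->
    [/\ exists G, parabolic_green X lam G,
        exists g, elliptic_green X lam g,
        forall G, parabolic_green X lam G -> forall p : R, d0' + 1 <= p ->
          (Lnorm (@lebesgue_measure R \x lebesgue_vec R d) (p / (p - 1))%:E
             (fun z => (if 0 <= z.1 then G z else 0)%:E)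
           <= (NG delta d Rlow p0 p *
               (lam * Num.min 1 lam `^ (d%:R / (2 * p - d%:R - 2)))
                 `^ ((d%:R + 2) / (2 * p) - 1))%:E)%E
      & forall g, elliptic_green X lam g -> forall p : R, d0' <= p ->
          (Lnorm (lebesgue_vec R d) (p / (p - 1))%:E (EFin \o g)
           <= (Ng delta d Rlow p0 p *
               (lam * Num.min 1 lam `^ (d%:R / (2 * p - d%:R)))
                 `^ (d%:R / (2 * p) - 1))%:E)%E]].

End constants.

(* Main.v *)
Require Import Defs.
From HB Require Import structures.
From mathcomp Require Import all_boot all_order all_algebra.
From mathcomp Require Import all_classical all_reals all_analysis.
From mathcomp Require Import measurable_realfun ess_sup_inf ring lra.

(** The time spent by the process in a set before leaving the cylinder is
    controlled by its Green function. On the event that the path is still in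
    the cylinder one has t < r^2, so with lambda = r^-2 the factor
    e^(1 - lambda t) is at least 1 and the expected integral is at most e times
    the integral of f, extended by zero outside the cylinder, against the Green
    function G of the discounted process (expect_int_le_green). From
    there on the problem is one about a nonnegative weight on the product of the
    time axis and R^d.

    Three estimates on that weight are at hand:
    - G lies in the dual of L_(d0+1) of space-time (joint_bound_green);
    - its time marginal is e^(-lambda t) dt on t >= 0, hence at most Lebesgue measure
      (marginal_bound_time);
    - its space marginal is the elliptic Green function, which lies in the dual
      of L_d0 of R^d (marginal_bound_space).

    They are the cases (p, q) = (d0+1, d0+1), (oo, 1) and (d0, oo) of the claim,
    and every admissible pair lies on the segment between the first and one of
    the other two. The interpolation is a single use of Hoelder's inequality
    (weighted_mixed_bound): if phi is the inner norm of f, write f as phi^a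
    times f / phi^a. A power of the first factor depends on the outer variable
    only and is estimated by the marginal bound; a power of the second has, after
    the inner integration, the same phi^Q as integrand, and is estimated by the
    joint bound. Homogeneity then produces the mixed norm.

    The powers of r come from the scaling of the constants in the Green
    function estimates at lambda = r^-2. The correction min(1, lambda) is bounded
    below by min(1, Rbar^-2), which is how the constant depends on Rbar
    (green_factorP). *)

Set Implicit Arguments.
Unset Strict Implicit.
Unset Printing Implicit Defensive.

Import Order.TTheory GRing.Theory Num.Theory.
Import numFieldNormedType.Exports.

Local Open Scope classical_set_scope.
Local Open Scope ring_scope.

(** * Integrals, powers and sections *)

Lemma le_poweR (R : realType) (x y : \bar R) (t : R) :
  0 <= t -> (0 <= x)%E -> (x <= y)%E ->
  (x `^ t <= y `^ t)%E.
Proof.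
move=> t0 x0 xy; apply: gt0_ler_poweR => //; rewrite in_itv/= leey andbT //.
exact: le_trans xy.
Qed.

Section integration_tools.
Context (R : realType) (disp : measure_display) (T : measurableType disp).
Variable mu : {measure set T -> \bar R}.

(** The integral of a nonnegative function is a supremum over the simple
    functions below it, so monotonicity holds with no measurability at all. This
    is what makes it possible to compare integrals up to an exit time without
    showing that the exit time is measurable. *)
Lemma le_integral_restrict (D E : set T) (f g : T -> \bar R) :
  D `<=` E -> (forall x, D x -> 0 <= f x)%E -> (forall x, E x -> 0 <= g x)%E ->
  (forall x, D x -> f x <= g x)%E ->
  (\int[mu]_(x in D) f x <= \int[mu]_(x in E) g x)%E.
Proof.
move=> DE f0 g0 fg; rewrite !ge0_integralE//.
apply: ereal_sup_le => _ [h /= hf <-]; exists h => //= x.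
rewrite (le_trans (hf x))// /patch; case: ifPn; rewrite ?inE => Dx.
  by rewrite mem_set ?fg//; exact: DE.
by case: ifPn => //; rewrite inE => Ex; exact: g0.
Qed.

Lemma measurable_fun_powR (f : T -> R) (t : R) :
  measurable_fun setT f -> measurable_fun setT (fun x => f x `^ t).
Proof. exact: (@measurableT_comp _ _ _ _ _ _ (@powR R ^~ t)). Qed.

Lemma measurable_fun_poweR (f : T -> \bar R) (t : R) :
  measurable_fun setT f -> measurable_fun setT (fun x => f x `^ t)%E.
Proof. by move=> mf; exact: (measurableT_comp (measurable_poweR t) mf). Qed.

Lemma Lnorm_EFin (F : T -> R) (n : R) : (forall z, 0 <= F z) ->
  (Lnorm mu n%:E (EFin \o F) = (\int[mu]_z (F z `^ n)%:E) `^ n^-1)%E.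
Proof.
move=> F0; rewrite Lnorm.unlock.
have -> // : (\int[mu]_z `|(EFin \o F) z| `^ n = \int[mu]_z (F z `^ n)%:E)%E.
by apply: eq_integral => z _ /=; rewrite ger0_norm.
Qed.

(** Hoelder's inequality for the measure with density G, obtained by sharing
    G between the two factors as G^(1/s') G^(1/s). *)
Lemma weighted_hoelder (G a b : T -> R) (s s' : R) :
  measurable_fun setT G -> measurable_fun setT a -> measurable_fun setT b ->
  (forall x, 0 <= G x) -> (forall x, 0 <= a x) -> (forall x, 0 <= b x) ->
  0 < s -> 0 < s' -> s^-1 + s'^-1 = 1 ->
  (\int[mu]_x (a x * b x * G x)%:E <=
   (\int[mu]_x (a x `^ s' * G x)%:E) `^ s'^-1 *
   (\int[mu]_x (b x `^ s * G x)%:E) `^ s^-1)%E.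
Proof.
move=> mG ma mb G0 a0 b0 s0 s'0 ss'.
pose u x := a x * G x `^ s'^-1; pose v x := b x * G x `^ s^-1.
have mu_ : measurable_fun setT u.
  apply: measurable_funM => //.
  exact: measurable_fun_powR.
have mv : measurable_fun setT v.
  apply: measurable_funM => //.
  exact: measurable_fun_powR.
have powG t x : t != 0 -> (G x `^ t^-1) `^ t = G x.
  by move=> t0; rewrite -powRrM mulVf// powRr1.
have NE (w : T -> R) t : 0 < t -> (forall x, 0 <= w x) ->
    ((\int[mu]_x (w x `^ t * G x)%:E) `^ t^-1 =
     Lnorm mu t%:E (EFin \o (fun x => w x * G x `^ t^-1)%R))%E.
  move=> t0 w0; rewrite Lnorm_EFin; last by move=> x; rewrite mulr_ge0 ?powR_ge0.
  under [in RHS]eq_integral do rewrite powRM ?powR_ge0// powG ?gt_eqF//.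
  by [].
have ss : s'^-1 + s^-1 = 1 by rewrite addrC.
have uvE : (Lnorm mu 1 (EFin \o (u \* v)%R) =
    \int[mu]_x (a x * b x * G x)%:E)%E.
  rewrite Lnorm1; apply: eq_integral => x _ /=.
  rewrite ger0_norm; last by rewrite !mulr_ge0// powR_ge0.
  rewrite mulrACA -powRD; first by rewrite ss powRr1.
  by rewrite ss oner_eq0.
have := hoelder mu mu_ mv s'0 s0 ss.
by rewrite uvE -(NE a s' s'0 a0) -(NE b s s0 b0).
Qed.

(** A weight in the dual Lebesgue space acts as a bounded functional; n / (n - 1)
    is the exponent conjugate to n. *)
Lemma dual_bound (h F : T -> R) (n A : R) :
  1 < n -> measurable_fun setT h -> (forall z, 0 <= h z) ->
  measurable_fun setT F -> (forall z, 0 <= F z) ->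
  (Lnorm mu (n / (n - 1))%:E (EFin \o h) <= A%:E)%E ->
  (\int[mu]_z (F z * h z)%:E <= A%:E * (\int[mu]_z (F z `^ n)%:E) `^ n^-1)%E.
Proof.
move=> n1 mh h0 mF F0 hA.
have n0 : 0 < n by exact: lt_trans n1.
have n10 : 0 < n - 1 by rewrite subr_gt0.
have conj : n^-1 + (n / (n - 1))^-1 = 1 by field; rewrite ?gt_eqF.
have := hoelder mu mF mh n0 (divr_gt0 n0 n10) conj.
rewrite (_ : Lnorm mu 1 _ = \int[mu]_z (F z * h z)%:E)%E; last first.
  by rewrite Lnorm1; apply: eq_integral => z _ /=; rewrite ger0_norm ?mulr_ge0.
rewrite (Lnorm_EFin n F0).
move=> /le_trans; apply; rewrite muleC.
by apply: lee_wpmul2r => //; exact: poweR_ge0.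
Qed.

Lemma ae_fin_num_integral (f : T -> \bar R) :
  measurable_fun setT f -> (forall x, 0 <= f x)%E ->
  (\int[mu]_x f x < +oo)%E -> {ae mu, forall x, f x \is a fin_num}.
Proof.
move=> mf f0 foo.
have /(integrable_ae measurableT) : mu.-integrable setT f.
  apply/integrableP; split=> //.
  by under eq_integral do rewrite gee0_abs//.
by apply: filterS => x; apply.
Qed.

Lemma ae_eq0_integral (f : T -> \bar R) :
  measurable_fun setT f -> (forall x, 0 <= f x)%E ->
  (\int[mu]_x f x = 0)%E -> {ae mu, forall x, f x = 0%E}.
Proof.
move=> mf f0 foo.
have /(ae_eq_integral_abs mu measurableT mf) : (\int[mu]_x `|f x| = 0)%E.
  by under eq_integral do rewrite gee0_abs//.
by apply: filterS => x; apply.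
Qed.

End integration_tools.

Section product_tools.
Context (R : realType) (d1 d2 : measure_display) (T1 : measurableType d1)
  (T2 : measurableType d2).
Variables (m1 : {sigma_finite_measure set T1 -> \bar R})
  (m2 : {sigma_finite_measure set T2 -> \bar R}).

Lemma ae_fst (Q : T1 -> Prop) :
  {ae m1, forall x, Q x} -> {ae (m1 \x m2)%E, forall z, Q z.1}.
Proof.
move=> [N [mN N0 QN]]; exists (N `*` setT); split.
- exact: measurableX.
- by rewrite [LHS]product_measure1E// [X in (X * _)%E]N0 mul0e.
- by move=> z /= Qz; split => //; exact: QN.
Qed.

Lemma integral_prod_swap (f : T1 * T2 -> \bar R) :
  measurable_fun setT f -> (forall z, 0 <= f z)%E ->
  (\int[m1 \x m2]_z f z = \int[m2 \x m1]_w f (w.2, w.1))%E.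
Proof.
move=> mf f0; rewrite fubini_tonelli2//.
rewrite fubini_tonelli1//.
have ms : measurable_fun setT (fun w : T2 * T1 => (w.2, w.1)).
  exact: measurable_swap.
exact: (measurableT_comp mf ms).
Qed.

(** The essential supremum of a section exceeds a exactly when the section of
    the superlevel set f > a has positive measure, and the measure of a section
    is a measurable function of the base point. *)
Lemma measurable_ess_sup_section (f : T1 * T2 -> \bar R) :
  measurable_fun setT f ->
  measurable_fun setT (fun x => ess_sup m2 (fun y => f (x, y))).
Proof.
move=> mf; apply: (measurability _ (ErealGenOInfty.measurableE R)) => //.
move=> _ [_ [a ->] <-]; rewrite setTI.
pose E := f @^-1` `]a%:E, +oo[.
have mE : measurable E.
  by rewrite -[E]setTI; apply: mf => //; exact: emeasurable_itv.
have mf_ x : measurable_fun setT (fun y => f (x, y)).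
  exact: measurableT_comp mf (measurable_pair1 x).
have xE x : xsection E x = (fun y => f (x, y)) @^-1` `]a%:E, +oo[.
  by apply/seteqP; split => y; rewrite /xsection /= inE.
rewrite [X in measurable X](_ : _ =
   [set x | (0 < (m2 \o xsection E) x)%E]); last first.
  apply/seteqP; split=> x /=; rewrite in_itv/= andbT => H.
    rewrite lt0e measure_ge0 andbT; apply/eqP => m0; move: H.
    by apply/negP; rewrite -leNgt; apply/ess_supP/ae_le_measureP; rewrite -?xE.
  rewrite ltNge; apply/negP => /ess_supP/ae_le_measureP => /(_ (mf_ x)).
  by rewrite -xE => m0; move: H; rewrite m0 ltxx.
rewrite -[X in measurable X]setTI.
apply: emeasurable_fun_o_infty => //.
exact: measurable_fun_xsection.
Qed.

End product_tools.

(** * Mixed-norm bounds for a weight *)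

Section mixed_bounds.
Context (R : realType) (d1 d2 : measure_display) (T1 : measurableType d1)
  (T2 : measurableType d2).
Variables (m1 : {sigma_finite_measure set T1 -> \bar R})
  (m2 : {sigma_finite_measure set T2 -> \bar R}).
Variable G : T1 * T2 -> R.
Hypotheses (mG : measurable_fun setT G) (G0 : forall z, 0 <= G z).

(** Bounds on a weight are phrased by duality, through test functions: this is
    the form in which the expectation formulas for Green functions yield them,
    and it speaks of a marginal density without constructing it. *)
Definition marginal_bound (m B : R) := forall psi : T1 -> R,
  measurable_fun setT psi -> (forall x, 0 <= psi x) ->
  (\int[m1 \x m2]_z (psi z.1 * G z)%:E <=
   B%:E * (\int[m1]_x (psi x `^ m)%:E) `^ m^-1)%E.

Definition joint_bound (n A : R) := forall F : T1 * T2 -> R,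
  measurable_fun setT F -> (forall z, 0 <= F z) ->
  (\int[m1 \x m2]_z (F z * G z)%:E <=
   A%:E * (\int[m1 \x m2]_z (F z `^ n)%:E) `^ n^-1)%E.

Lemma Lnorm_iterated (f : T1 * T2 -> R) (P Q : R) : (forall z, 0 <= f z) ->
  (Lnorm m1 Q%:E (fun x => Lnorm m2 P%:E (fun y => (f (x, y))%:E)) =
   (\int[m1]_x (\int[m2]_y (f (x, y) `^ P)%:E) `^ (Q / P)) `^ Q^-1)%E.
Proof.
move=> f0.
have innerE x : Lnorm m2 P%:E (fun y => (f (x, y))%:E) =
    ((\int[m2]_y (f (x, y) `^ P)%:E) `^ P^-1)%E.
  exact: (@Lnorm_EFin _ _ _ m2 (fun y => f (x, y)) P (fun y => f0 (x, y))).
rewrite (funext innerE) Lnorm.unlock.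
under eq_integral do rewrite gee0_abs ?poweR_ge0// -poweRrM mulrC.
by [].
Qed.

Lemma diagonal_mixed_bound (n A : R) (f : T1 * T2 -> R) :
  0 < n -> joint_bound n A -> measurable_fun setT f -> (forall z, 0 <= f z) ->
  (\int[m1 \x m2]_z (f z * G z)%:E <=
   A%:E * Lnorm m1 n%:E (fun x => Lnorm m2 n%:E (fun y => (f (x, y))%:E)))%E.
Proof.
move=> n0 HA mf f0; rewrite Lnorm_iterated// (le_trans (HA _ mf f0))//.
rewrite fubini_tonelli1//.
- rewrite le_eqVlt; apply/orP; left; apply/eqP; congr (_ * _ `^ _)%E.
  apply: eq_integral => x _; rewrite divff ?gt_eqF// poweRe1//.
  by apply: integral_ge0 => y _; rewrite lee_fin powR_ge0.
- exact/measurable_EFinP/measurable_fun_powR.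
- by move=> z; rewrite lee_fin powR_ge0.
Qed.

(** Multiplied by the indicator of the base points whose section integrates to
    zero, f has integral zero by Tonelli's theorem. *)
Lemma ae_eq0_section (f : T1 * T2 -> \bar R) :
  measurable_fun setT f -> (forall z, 0 <= f z)%E ->
  {ae (m1 \x m2)%E, forall z, (\int[m2]_y f (z.1, y) = 0)%E -> (f z = 0)%E}.
Proof.
move=> mf f0.
pose J x := (\int[m2]_y f (x, y))%E.
have mJ : measurable_fun setT J by exact: measurable_fun_fubini_tonelli_F.
pose N := [set x | J x = 0%E].
have mN : measurable N.
  by rewrite -[N]setTI; exact: mJ (emeasurable_set1 0).
pose h z := (f z * (\1_N z.1)%:E)%E.
have mh : measurable_fun setT h.
  apply: emeasurable_funM => //; apply/measurable_EFinP.
  exact: (measurableT_comp (measurable_indic mN) measurable_fst).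
have h0 z : (0 <= h z)%E by rewrite mule_ge0// lee_fin.
have : {ae (m1 \x m2)%E, forall z, h z = 0%E}.
  apply: ae_eq0_integral => //; rewrite fubini_tonelli1//.
  apply: integral0_eq => x _; rewrite /fubini_F /h /=.
  rewrite indicE; have [|_] := boolP (x \in N); last first.
    by apply: integral0_eq => y _; rewrite mule0.
  rewrite inE => Nx; rewrite -[RHS]Nx.
  by apply: eq_integral => y _; rewrite mule1.
apply: filterS => z; rewrite /h indicE => hz Jz.
by move: hz; rewrite (mem_set (Jz : N z.1)) mule1.
Qed.

(** Hoelder's inequality with exponent s = P / n interpolates between the joint
    bound on L_n and the marginal bound on L_m. The relation between P and Q
    says that (1/P, 1/Q) lies on the segment from (1/n, 1/n) to (0, 1/m). *)
Lemma weighted_mixed_bound (n m A B P Q : R) (f : T1 * T2 -> R) :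
  0 < n < P -> 0 < m -> 0 < Q -> (P - Q) * m = Q * (P - n) ->
  0 < A -> 0 < B ->
  joint_bound n A -> marginal_bound m B ->
  measurable_fun setT f -> (forall z, 0 <= f z) ->
  (\int[m1 \x m2]_z (f z * G z)%:E <=
   (A `^ (n / P) * B `^ (1 - n / P))%:E *
   Lnorm m1 Q%:E (fun x => Lnorm m2 P%:E (fun y => (f (x, y))%:E)))%E.
Proof.
move=> /andP[n0 nP] m0 Q0 PQ A0 B0 HA HB mf f0.
have P0 : 0 < P by exact: lt_trans nP.
have Pn0 : 0 < P - n by rewrite subr_gt0.
have QP0 : 0 < Q / P by rewrite divr_gt0.
rewrite Lnorm_iterated//.
set J := fun x => (\int[m2]_y (f (x, y) `^ P)%:E)%E.
have fP0 z : (0 <= (f z `^ P)%:E)%E by rewrite lee_fin powR_ge0.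
have mfP : measurable_fun setT (fun z => (f z `^ P)%:E).
  exact/measurable_EFinP/measurable_fun_powR.
have mJ : measurable_fun setT J.
  exact: (@measurable_fun_fubini_tonelli_F _ _ T1 T2 R m2 _ mfP fP0).
have J0 x : (0 <= J x)%E by apply: integral_ge0.
set K := (\int[m1]_x (J x `^ (Q / P)))%E.
have K0 : (0 <= K)%E by apply: integral_ge0 => x _; exact: poweR_ge0.
(* J ^ (1/P) is the inner norm and K the Q-th power of the mixed norm; if K is
   infinite the right-hand side is +oo because A and B are positive. *)
have [Koo|Koo] := eqVneq K +oo%E.
  rewrite Koo poweRyr ?invr_eq0 ?gt_eqF// gt0_muley ?leey//.
  by rewrite lte_fin mulr_gt0// powR_gt0.
pose kappa x := fine (J x).
have mk : measurable_fun setT kappa.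
  exact: (@measurableT_comp _ _ _ _ _ _ fine).
have k0 x : 0 <= kappa x by rewrite fine_ge0.
(* Since fine +oo = 0 and 0 ^ (- al) = 0, the factorization f = a * b below
   breaks down where J is infinite or zero: the first set is null because K is
   finite, and f vanishes almost everywhere on the second. *)
(* al is the exponent for which kappa ^ (- al * P) * J = kappa ^ (Q / P), so that
   both Hoelder factors lead back to K. *)
pose al := (1 - Q / P) / P.
pose s := P / n.
pose s' := P / (P - n).
pose a (z : T1 * T2) := kappa z.1 `^ al.
pose b z := kappa z.1 `^ (- al) * f z.
have mk1 : measurable_fun setT (fun z : T1 * T2 => kappa z.1).
  exact: (measurableT_comp mk measurable_fst).
have ma : measurable_fun setT a by exact: measurable_fun_powR.
have mb : measurable_fun setT b.
  by apply: measurable_funM => //; exact: measurable_fun_powR.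
have a0 z : 0 <= a z by exact: powR_ge0.
have b0 z : 0 <= b z by rewrite mulr_ge0// powR_ge0.
have factorE : (\int[m1 \x m2]_z (f z * G z)%:E =
    \int[m1 \x m2]_z (a z * b z * G z)%:E)%E.
  apply: ge0_ae_eq_integral => //.
  - by apply/measurable_EFinP/measurable_funM.
  - by apply/measurable_EFinP/measurable_funM => //; exact: measurable_funM.
  - by move=> z _; rewrite lee_fin mulr_ge0.
  - by move=> z _; rewrite lee_fin mulr_ge0// mulr_ge0.
  have JQfin : {ae m1, forall x, (J x `^ (Q / P))%E \is a fin_num}.
    apply: ae_fin_num_integral => //; first exact: measurable_fun_poweR.
      by move=> x; exact: poweR_ge0.
    by rewrite ltey.
  have := ae_fst m2 JQfin.
  have := ae_eq0_section mfP fP0.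
  apply: filterS2 => z fz0 Jfin _; congr ((_ * _)%:E).
  have Jf : J z.1 \is a fin_num.
    rewrite ge0_fin_numE//; apply: (@lty_poweRy _ _ (Q / P)).
      by rewrite gt_eqF.
    by rewrite -ge0_fin_numE ?poweR_ge0.
  rewrite /a /b mulrA; have [k00|kn0] := eqVneq (kappa z.1) 0.
    have : ((f z `^ P)%:E = 0)%E.
      by apply: fz0; rewrite -/(J _) -[LHS]fineK// -/(kappa _) k00.
    by move=> [] /powR_eq0_eq0 ->; rewrite mulr0.
  by rewrite -powRD ?kn0 ?implybT// subrr powRr0 mul1r.
rewrite factorE.
have sn0 : s^-1 + s'^-1 = 1 by rewrite /s /s'; field; rewrite ?gt_eqF.
have s0 : 0 < s by rewrite divr_gt0.
have s'0 : 0 < s' by rewrite divr_gt0.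
apply: (le_trans (weighted_hoelder _ mG ma mb G0 a0 b0 s0 s'0 sn0)).
have kJ x : ((kappa x `^ (Q / P))%:E <= J x `^ (Q / P))%E.
  rewrite /kappa; case: (J x) (J0 x) => [r _ //|_|//].
  by rewrite poweRyr ?gt_eqF ?leey.
have mJQ : measurable_fun setT (fun x => J x `^ (Q / P))%E.
  exact: measurable_fun_poweR.
have int_a_le : (\int[m1 \x m2]_z (a z `^ s' * G z)%:E <= B%:E * K `^ m^-1)%E.
  apply: (le_trans (HB (fun x => (kappa x `^ al) `^ s') _ _)).
  - by do 2 apply: measurable_fun_powR.
  - by move=> x; exact: powR_ge0.
  rewrite lee_pmul2l ?lte_fin//; apply: le_poweR.
  - by rewrite invr_ge0 ltW.
  - by apply: integral_ge0 => x _; rewrite lee_fin powR_ge0.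
  apply: ge0_le_integral => //.
  - by move=> x _; rewrite lee_fin powR_ge0.
  - by apply/measurable_EFinP; do 3 apply: measurable_fun_powR.
  move=> x _; rewrite -!powRrM (_ : al * (s' * m) = Q / P) ?kJ//.
  rewrite /al /s'.
  have -> : (1 - Q / P) / P * (P / (P - n) * m) = ((P - Q) * m) / (P * (P - n)).
    by field; rewrite ?gt_eqF.
  by rewrite PQ; field; rewrite ?gt_eqF.
have int_b_le : (\int[m1 \x m2]_z (b z `^ s * G z)%:E <= A%:E * K `^ n^-1)%E.
  apply: (le_trans (HA (fun z => b z `^ s) _ _)).
  - exact: measurable_fun_powR.
  - by move=> z; exact: powR_ge0.
  rewrite lee_pmul2l ?lte_fin//; apply: le_poweR.
  - by rewrite invr_ge0 ltW.
  - by apply: integral_ge0 => z _; rewrite lee_fin powR_ge0.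
  rewrite fubini_tonelli1; last 2 first.
  - by apply/measurable_EFinP; do 2 apply: measurable_fun_powR.
  - by move=> z; rewrite lee_fin powR_ge0.
  have innerE x : fubini_F m2 (fun z => ((b z `^ s) `^ n)%:E) x =
      ((kappa x `^ (- al * P))%:E * J x)%E.
    rewrite /fubini_F -ge0_integralZl_EFin//; last 2 first.
    - exact: (measurableT_comp mfP (measurable_pair1 x)).
    - exact: powR_ge0.
    apply: eq_integral => y _; rewrite -EFinM -powRrM divfK ?gt_eqF//.
    by rewrite /b /= powRM ?powR_ge0// -powRrM.
  under eq_integral do rewrite innerE.
  apply: ge0_le_integral => //.
  - by move=> x _; rewrite mule_ge0// lee_fin powR_ge0.
  - apply: emeasurable_funM => //.
    by apply/measurable_EFinP; exact: measurable_fun_powR.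
  move=> x _; rewrite /kappa; case: (J x) (J0 x) => [r r0|_|//]; last first.
    by rewrite poweRyr ?leey ?gt_eqF.
  rewrite -EFinM poweR_EFin lee_fin.
  have [->|rn0] := eqVneq r 0; first by rewrite mulr0 powR_ge0.
  rewrite -{2}(powRr1 r0) -powRD ?rn0 ?implybT//.
  rewrite (_ : - al * P + 1 = Q / P)// /al.
  by field; rewrite ?gt_eqF.
apply: (@le_trans _ _ ((B%:E * K `^ m^-1) `^ s'^-1 * (A%:E * K `^ n^-1) `^ s^-1)%E).
  apply: lee_pmul; rewrite ?poweR_ge0//; apply: le_poweR => //.
  - by rewrite invr_ge0 ltW.
  - by apply: integral_ge0 => z _; rewrite lee_fin mulr_ge0 ?powR_ge0.
  - by rewrite invr_ge0 ltW.
  - by apply: integral_ge0 => z _; rewrite lee_fin mulr_ge0 ?powR_ge0.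
rewrite !poweRM ?poweR_ge0 ?lee_fin ?(ltW A0) ?(ltW B0)// muleACA -!poweRrM.
have exps : m^-1 / s' + n^-1 / s = Q^-1.
  have Pnm : P * m = Q * (P - n + m) by move: PQ; lra.
  have Pm0 : 0 < P * m by rewrite mulr_gt0.
  have -> : m^-1 / s' + n^-1 / s = (P - n + m) / (P * m).
    by rewrite /s /s'; field; rewrite ?gt_eqF.
  have nm0 : 0 < P - n + m by rewrite addr_gt0.
  by rewrite Pnm; field; rewrite ?gt_eqF.
rewrite -poweRD; last by apply: add_neq0_poweRD_def; rewrite exps invr_neq0// gt_eqF.
have Es : s^-1 = n / P by rewrite /s invf_div.
have Es' : s'^-1 = 1 - n / P by rewrite /s'; field; rewrite ?gt_eqF.
by rewrite exps !poweR_EFin -EFinM Es Es' [B `^ _ * _]mulrC.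
Qed.

(** The exceptional set has null sections by definition of the essential
    supremum; it is null by Tonelli's theorem because the essential supremum of
    a section depends measurably on the base point. *)
Lemma ae_le_Lnormy (f : T1 * T2 -> R) :
  measurable_fun setT f -> (forall z, 0 <= f z) ->
  let psi x := Lnorm m2 +oo%E (fun y => (f (x, y))%:E) in
  measurable_fun setT psi /\
  {ae (m1 \x m2)%E, forall z, ((f z)%:E <= psi z.1)%E}.
Proof.
move=> mf f0 psi.
have mEf : measurable_fun setT (fun z => (f z)%:E) by exact/measurable_EFinP.
have fabs x : abse \o (fun y => (f (x, y))%:E) = fun y => (f (x, y))%:E.
  by apply/funext => y /=; rewrite ger0_norm.
have psiE x : psi x =
    if (0 < m2 setT)%E then ess_sup m2 (fun y => (f (x, y))%:E) else 0%E.
  by rewrite /psi unlock fabs.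
have mpsi : measurable_fun setT psi.
  rewrite (_ : psi = fun x => if (0 < m2 setT)%E
      then ess_sup m2 (fun y => (f (x, y))%:E) else 0%E); last exact/funext.
  case: (boolP (0 < m2 setT)%E) => _ //.
  exact: (@measurable_ess_sup_section _ _ _ _ _ m2 _ mEf).
split=> //.
have ae_psi x : {ae m2, forall y, ((f (x, y))%:E <= psi x)%E}.
  rewrite psiE; have [m2T|] := boolP (0 < m2 setT)%E; first exact: ess_sup_ge.
  rewrite -leNgt measure_le0 => /eqP m20.
  by exists setT; split.
pose N := [set z | (psi z.1 < (f z)%:E)%E].
have mN : measurable N.
  rewrite -[N]setTI; apply: emeasurable_fun_lt => //.
  exact: measurableT_comp mpsi measurable_fst.
exists N; split => //; last by move=> z /= /negP; rewrite -ltNge.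
rewrite /= /product_measure1; apply: integral0_eq => x _ /=.
have [M [mM M0 NM]] := ae_psi x.
apply: (subset_measure0 _ mM _ M0); first exact: measurable_xsection.
move=> y; rewrite /xsection /= inE => Nxy; apply: NM => /=.
by apply/negP; rewrite -ltNge.
Qed.

(** For an infinite inner exponent the marginal bound does the work: the
    function is dominated almost everywhere by its inner essential supremum,
    which is a function of the outer variable alone. *)
Lemma endpoint_mixed_bound (m B : R) (f : T1 * T2 -> R) :
  0 < m -> 0 < B -> marginal_bound m B ->
  measurable_fun setT f -> (forall z, 0 <= f z) ->
  (\int[m1 \x m2]_z (f z * G z)%:E <=
   B%:E * Lnorm m1 m%:E (fun x => Lnorm m2 +oo%E (fun y => (f (x, y))%:E)))%E.
Proof.
move=> m0 B0 HB mf f0; have [] := ae_le_Lnormy mf f0.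
set psi := fun x => Lnorm m2 _ _ => mpsi fpsi.
have psi0 x : (0 <= psi x)%E by exact: Lnorm_ge0.
rewrite unlock; set K := (\int[m1]_x _)%E.
have KE : K = (\int[m1]_x (psi x `^ m))%E.
  by apply: eq_integral => x _; rewrite gee0_abs.
have [Koo|Koo] := eqVneq K +oo%E.
  by rewrite Koo poweRyr ?invr_eq0 ?gt_eqF// gt0_muley ?leey// lte_fin.
pose kappa x := fine (psi x).
have mk : measurable_fun setT kappa.
  exact: (@measurableT_comp _ _ _ _ _ _ fine).
have k0 x : 0 <= kappa x by rewrite fine_ge0.
have psifin : {ae m1, forall x, (psi x `^ m)%E \is a fin_num}.
  apply: ae_fin_num_integral => //; first exact: measurable_fun_poweR.
    by move=> x; exact: poweR_ge0.
  by rewrite -KE ltey.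
apply: (@le_trans _ _ (\int[m1 \x m2]_z (kappa z.1 * G z)%:E)%E).
  apply: ae_ge0_le_integral => //.
  - by move=> z _; rewrite lee_fin mulr_ge0.
  - by apply/measurable_EFinP/measurable_funM.
  - by move=> z _; rewrite lee_fin mulr_ge0.
  - apply/measurable_EFinP/measurable_funM => //.
    exact: (measurableT_comp mk measurable_fst).
  have := ae_fst m2 psifin; move: fpsi; apply: filterS2 => z fz psiz _.
  rewrite lee_fin ler_wpM2r// -lee_fin fineK//.
  rewrite ge0_fin_numE//; apply: (@lty_poweRy _ _ m); first by rewrite gt_eqF.
  by rewrite -ge0_fin_numE ?poweR_ge0.
apply: (le_trans (HB _ mk k0)).
rewrite lee_pmul2l ?lte_fin//; apply: le_poweR.
- by rewrite invr_ge0 ltW.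
- by apply: integral_ge0 => x _; rewrite lee_fin powR_ge0.
rewrite KE; apply: ge0_le_integral => //.
- by move=> x _; rewrite lee_fin powR_ge0.
- by apply/measurable_EFinP; exact: measurable_fun_powR.
- exact: measurable_fun_poweR.
move=> x _; rewrite /kappa; case: (psi x) (psi0 x) => [r _ //|_|//].
by rewrite poweRyr ?gt_eqF ?leey.
Qed.

End mixed_bounds.

(** * Translation invariance of Lebesgue measure *)

Section measure_preserving.
Context (R : realType).

Definition preserves (d : measure_display) (T : measurableType d)
    (mu : set T -> \bar R) (phi : T -> T) : Prop :=
  measurable_fun setT phi /\
  forall A, measurable A -> mu (phi @^-1` A) = mu A.

Lemma integral_preserves (d : measure_display) (T : measurableType d)
    (mu : {measure set T -> \bar R}) (phi : T -> T) (f : T -> \bar R) :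
  preserves mu phi -> measurable_fun setT f -> (forall x, 0 <= f x)%E ->
  (\int[mu]_x f (phi x) = \int[mu]_x f x)%E.
Proof.
move=> [mphi muphi] mf f0.
rewrite -[LHS](ge0_integral_pushforward mphi mu (D := setT) (f := f))//.
by apply: eq_measure_integral => A mA _; exact: muphi.
Qed.

Lemma product_preserves (d1 d2 : measure_display) (T1 : measurableType d1)
    (T2 : measurableType d2) (m1 : {sigma_finite_measure set T1 -> \bar R})
    (m2 : {sigma_finite_measure set T2 -> \bar R})
    (phi1 : T1 -> T1) (phi2 : T2 -> T2) :
  preserves m1 phi1 -> preserves m2 phi2 ->
  preserves (m1 \x m2)%E (fun z => (phi1 z.1, phi2 z.2)).
Proof.
move=> p1 p2; split.
  apply/measurable_fun_pairP; split.
    exact: measurableT_comp p1.1 measurable_fst.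
  exact: measurableT_comp p2.1 measurable_snd.
move=> A mA; rewrite /= /product_measure1.
pose h x := m2 (xsection A x).
have mh : measurable_fun setT h by exact: (measurable_fun_xsection m2 mA).
rewrite -[RHS](integral_preserves p1 mh)//.
apply: eq_integral => x _; rewrite /h /=.
rewrite -(p2.2 (xsection A (phi1 x))); last exact: measurable_xsection.
by congr (m2 _); apply/seteqP; split=> y; rewrite /xsection /= !inE.
Qed.

Lemma preserves_id (d : measure_display) (T : measurableType d)
  (mu : set T -> \bar R) : preserves mu id.
Proof. by split. Qed.

Lemma lebesgue_measure_translation (a : R) :
  preserves (@lebesgue_measure R) (fun x : measurableTypeR R => a + x).
Proof.
have ma : measurable_fun setT (fun x : measurableTypeR R => a + x).
  exact: measurable_funD.
split=> // A mA.
rewrite -[LHS]/(pushforward lebesgue_measure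
  ((fun x => a + x) : _ -> measurableTypeR R) A).
apply/esym/lebesgue_measure_unique => //= _ [[u v]] _ <-.
rewrite /pushforward (_ : _ @^-1` _ = `](u - a), (v - a)]%classic); last first.
  by apply/seteqP; split=> y /=; rewrite !in_itv/= ltrBlDl lerBrDl.
rewrite !lebesgue_measure_itv/= !lte_fin ltrD2r.
by case: ifP => // _; rewrite -!EFinB; congr (_%:E); ring.
Qed.

Lemma measurable_translation (n : nat) (x : 'cV[R]_n) :
  measurable_fun setT (fun y => x + y).
Proof.
apply: measurable_fun_mx => i j; under eq_fun do rewrite mxE.
by apply: measurable_funD => //; exact: measurable_entry.
Qed.

(** Induction on the dimension: adding the first coordinate turns the measure
    into a product with the one-dimensional Lebesgue measure, and a product of
    measure-preserving maps preserves the product measure. *)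
Lemma lebesgue_vec_translation (n : nat) (x : 'cV[R]_n) :
  preserves (lebesgue_vec R n) (fun y => x + y).
Proof.
split; first exact: measurable_translation.
elim: n x => [|n IHn] x A mA.
  congr (lebesgue_vec R 0 _); apply/seteqP; split=> y /=;
    by rewrite (flatmx0 x) add0r.
pose phi1 (a : measurableTypeR R) := x ord0 ord0 + a.
pose phi2 (y : 'cV[R]_n) := (\col_i x (lift ord0 i) ord0) + y.
have p1 : preserves (@lebesgue_measure R) phi1.
  exact: lebesgue_measure_translation.
have p2 : preserves (lebesgue_vec R n) phi2.
  split; last exact: IHn.
  exact: measurable_translation.
have mB : measurable (@vcons R n @^-1` A).
  by rewrite -[X in measurable X]setTI; exact: measurable_vcons.
rewrite /= /lebesgue_vec_succ /pushforward -[RHS](product_preserves p1 p2).2//.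
congr (_ _); apply/seteqP; split=> -[a y] /=.
all: rewrite (_ : x + vcons (a, y) = vcons (phi1 a, phi2 y))//.
all: apply/colP => i; rewrite !mxE /phi1 /phi2 /=.
all: by case: unliftP => [j ->|->] //; rewrite !mxE.
Qed.

End measure_preserving.

(** * Green functions and the time spent before exit *)

Section occupation.
Context (R : realType) (d : nat) (delta : R) (X : ito_process d delta).

Lemma measurable_cylinder (T r : R) : 0 < r ->
  measurable (@cylinder R d T r).
Proof.
move=> r0.
pose S (z : R * 'cV[R]_d) := \sum_i \sum_j z.2 i j ^+ 2.
have mS : measurable_fun setT S.
  apply: measurable_sum => i; apply: measurable_sum => j.
  apply: measurable_funX.
  exact: (measurableT_comp (measurable_entry i j) measurable_snd).
have normE z : (enorm z.2 < r) = (S z < r ^+ 2).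
  by rewrite -[X in _ < X](gtr0_norm r0) -sqrtr_sqr ltr_sqrt// exprn_gt0.
have -> : @cylinder R d T r =
    (fst @^-1` `[0, T[%classic) `&` (S @^-1` `]-oo, (r ^+ 2)[%classic).
  by apply/seteqP; split=> z; rewrite /cylinder /= !in_itv/= normE.
apply: measurableI; rewrite -[X in measurable X]setTI.
  exact: (@measurable_fst _ _ R 'cV[R]_d measurableT _ (measurable_itv _)).
exact: (mS measurableT _ (measurable_itv _)).
Qed.

Definition extend0 (Q : set (R * 'cV[R]_d)) (f : R * 'cV[R]_d -> R) z :=
  if z \in Q then f z else 0.

(** Before the exit time the path lies in the cylinder, so f may be replaced by
    its extension by zero, and t < r^2 gives 1 <= e e^(- t / r^2). Enlarging the
    domain of integration to all times leaves the integral that defines the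
    Green function. *)
Lemma expect_int_le_green (G f : R * 'cV[R]_d -> R) (r : R) (x : 'cV[R]_d) :
  0 < r -> parabolic_green X (r ^- 2) G ->
  measurable_fun (cylinder (r ^+ 2) r) f ->
  (forall z, cylinder (r ^+ 2) r z -> 0 <= f z) ->
  (expect_int (tau X r x) (fun t omega => f (t, (x + ip_path t omega)%R)) <=
   \int[@lebesgue_measure R \x lebesgue_vec R d]_z
     (expR 1 * extend0 (cylinder (r ^+ 2) r) f (z.1, x + z.2) * G z)%:E)%E.
Proof.
move=> r0 [mG G0 _ GE] mf f0; set fC := extend0 _ _.
have mC := measurable_cylinder (r ^+ 2) r0.
have fC0 z : 0 <= fC z.
  by rewrite /fC /extend0; case: ifPn => //; rewrite inE => /f0.
have mfC : measurable_fun setT fC by exact/(measurable_restrictT f mC).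
have mF : measurable_fun setT (fun z => expR 1 * fC (z.1, x + z.2)).
  apply: measurable_funM => //; apply: (measurableT_comp mfC).
  exact: (product_preserves (m1 := lebesgue_measure)
    (preserves_id _) (lebesgue_vec_translation x)).1.
rewrite -(GE _ mF); last by move=> z; rewrite mulr_ge0 ?expR_ge0.
have in_cyl t omega : 0 <= t -> (t%:E < tau X r x omega)%E ->
    cylinder (r ^+ 2) r (t, x + ip_path t omega).
  move=> t0 ttau; apply: contrapT => nC; move: ttau; apply/negP.
  by rewrite -leNgt; apply: ereal_inf_lbound; exists t.
have F0 t omega : (0 <= (expR (- r ^- 2 * t) *
    (expR 1 * fC (t, x + ip_path t omega)))%:E)%E.
  by rewrite lee_fin !mulr_ge0 ?expR_ge0.
have f0' t omega : 0 <= t -> (t%:E < tau X r x omega)%E ->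
    (0 <= (f (t, x + ip_path t omega))%:E)%E.
  by move=> t0 ttau; rewrite lee_fin f0//; exact: in_cyl.
apply: le_integral_restrict => // omega _.
- by apply: integral_ge0 => t [t0 ttau]; exact: f0'.
- by apply: integral_ge0 => t _; exact: F0.
apply: le_integral_restrict => [t [t0 _]|t [t0 ttau]|t _|t [t0 ttau]].
- by split=> //; rewrite ltry.
- exact: f0'.
- exact: F0.
have Ct := in_cyl _ _ t0 ttau.
rewrite lee_fin /fC /extend0 mem_set// mulrA -expRD ler_peMl//; first exact: f0.
rewrite -expR0 ler_expR mulNr addrC subr_ge0 mulrC ler_pdivrMr ?exprn_gt0//.
by rewrite expR0 mul1r; case: Ct => /andP[_ /ltW].
Qed.
End occupation.

Section green_bounds.
Context (R : realType) (d : nat) (delta : R) (X : ito_process d delta).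
Variables (lam : R) (G : R * 'cV[R]_d -> R) (g : 'cV[R]_d -> R).
Hypotheses (lam0 : 0 < lam) (greenG : parabolic_green X lam G)
  (greeng : elliptic_green X lam g).
Variable x : 'cV[R]_d.

Local Notation leb := (@lebesgue_measure R).
Local Notation vol := (lebesgue_vec R d).

(** Translating the weight rather than f lets the starting point x disappear:
    the mixed norm is then taken of f itself. *)
Definition shifted_green (z : R * 'cV[R]_d) := G (z.1, z.2 - x).

Lemma shift_preserves :
  preserves (leb \x vol)%E (fun z => (z.1, x + z.2)).
Proof.
exact: (product_preserves (preserves_id _) (lebesgue_vec_translation x)).
Qed.

Lemma measurable_shifted_green : measurable_fun setT shifted_green.
Proof.
case: greenG => mG _ _ _; apply: (measurableT_comp mG).
have := (product_preserves (m1 := leb) (preserves_id _)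
  (lebesgue_vec_translation (- x))).1.
by under eq_fun do rewrite addrC.
Qed.

Lemma shifted_green_ge0 z : 0 <= shifted_green z.
Proof. by case: greenG => _ G0 _ _; exact: G0. Qed.

Lemma integral_shifted_green (F : R * 'cV[R]_d -> R) :
  measurable_fun setT F -> (forall z, 0 <= F z) ->
  (\int[leb \x vol]_z (F z * shifted_green z)%:E =
   \int[leb \x vol]_z (F (z.1, (x + z.2)%R) * G z)%:E)%E.
Proof.
move=> mF F0.
rewrite -(@integral_preserves _ _ _ (leb \x vol)%E _
  (fun z => (F z * shifted_green z)%:E) shift_preserves).
- by apply: eq_integral => -[t y] _; rewrite /shifted_green/= addrAC subrr add0r.
- apply/measurable_EFinP/measurable_funM => //.
  exact: measurable_shifted_green.
- by move=> z; rewrite lee_fin mulr_ge0// shifted_green_ge0.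
Qed.

Lemma joint_bound_green (n A : R) : 1 < n ->
  (Lnorm (leb \x vol) (n / (n - 1))%:E
     (fun z => (if 0 <= z.1 then G z else 0)%:E) <= A%:E)%E ->
  joint_bound leb vol shifted_green n A.
Proof.
move=> n1 GA F mF F0; case: greenG => mG G0 Gneg _.
have mFs := measurableT_comp mF shift_preserves.1.
rewrite integral_shifted_green//.
have GA' : (Lnorm (leb \x vol) (n / (n - 1))%:E (EFin \o G) <= A%:E)%E.
  move: GA; congr (_ <= _)%E; congr Lnorm; apply/funext => z /=.
  by case: ifPn => //; rewrite -ltNge => /ltW /Gneg ->.
have Fs0 z : 0 <= F (z.1, x + z.2) by exact: F0.
have := @dual_bound _ _ _ (leb \x vol)%E _ _ _ _ n1 mG G0 mFs Fs0 GA'.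
rewrite (@integral_preserves _ _ _ (leb \x vol)%E _
  (fun z => (F z `^ n)%:E) shift_preserves)//.
- exact/measurable_EFinP/measurable_fun_powR.
- by move=> z; rewrite lee_fin powR_ge0.
Qed.

(** Integrated against a function of time only, the Green function gives the
    discounted integral of that function, because P is a probability. *)
Lemma marginal_bound_time : marginal_bound leb vol shifted_green 1 1.
Proof.
move=> psi mpsi psi0; case: greenG => _ _ _ GE.
have mpsi1 : measurable_fun setT (fun z : R * 'cV[R]_d => psi z.1).
  exact: (measurableT_comp mpsi measurable_fst).
rewrite (integral_shifted_green mpsi1)// -(GE _ mpsi1)// /expect_int mul1e.
rewrite invr1 poweRe1; last by apply: integral_ge0 => t _; rewrite lee_fin powR_ge0.
set K := (\int[leb]_t _)%E.
have K0 : (0 <= K)%E by apply: integral_ge0 => t _; rewrite lee_fin powR_ge0.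
apply: (@le_trans _ _ (\int[ip_prob X]_omega K)%E).
  apply: le_integral_restrict => // omega _.
    by apply: integral_ge0 => t _; rewrite lee_fin mulr_ge0// expR_ge0.
  apply: le_integral_restrict => // t; try (by move=> _; rewrite lee_fin powR_ge0).
    by move=> _; rewrite lee_fin mulr_ge0// expR_ge0.
  move=> [t0 _]; rewrite lee_fin.
  rewrite powRr1// ler_piMl// -expR0 ler_expR mulNr oppr_le0 mulr_ge0//.
  exact: ltW.
rewrite integral_cst//= (_ : ip_prob X _ = 1%E) ?mule1//.
exact: probability_setT.
Qed.

(** For functions of the position only the parabolic and the elliptic Green
    functions represent the same discounted functional, so the space marginal of
    the former is controlled by the norm of the latter. *)
Lemma marginal_bound_space (n A : R) : 1 < n ->
  (Lnorm vol (n / (n - 1))%:E (EFin \o g) <= A%:E)%E ->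
  marginal_bound vol leb (fun w => shifted_green (w.2, w.1)) n A.
Proof.
move=> n1 gA psi mpsi psi0; case: greenG => mG G0 _ GE.
case: greeng => mg g0 gE.
have mpsi2 : measurable_fun setT (fun z : R * 'cV[R]_d => psi z.2).
  exact: (measurableT_comp mpsi measurable_snd).
have mpsis : measurable_fun setT (fun y => psi (x + y)).
  exact: (measurableT_comp mpsi (measurable_translation x)).
rewrite -(@integral_prod_swap _ _ _ _ _ leb vol
  (fun z => (psi z.2 * shifted_green z)%:E)).
- rewrite (integral_shifted_green mpsi2)//.
  rewrite -(GE (fun z => psi (x + z.2)))//; last first.
    exact: (measurableT_comp mpsis measurable_snd).
  rewrite (gE (fun y => psi (x + y)))//.
  have := dual_bound n1 mg g0 mpsis (fun y => psi0 (x + y)) gA.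
  rewrite (@integral_preserves _ _ _ vol _
    (fun z => (psi z `^ n)%:E) (lebesgue_vec_translation x))//.
  - exact/measurable_EFinP/measurable_fun_powR.
  - by move=> z; rewrite lee_fin powR_ge0.
- apply/measurable_EFinP/measurable_funM => //.
  exact: measurable_shifted_green.
- by move=> z; rewrite lee_fin mulr_ge0// shifted_green_ge0.
Qed.

End green_bounds.

Lemma joint_bound_swap (R : realType) (d1 d2 : measure_display)
    (T1 : measurableType d1) (T2 : measurableType d2)
    (m1 : {sigma_finite_measure set T1 -> \bar R})
    (m2 : {sigma_finite_measure set T2 -> \bar R}) (G : T1 * T2 -> R) (n A : R) :
  measurable_fun setT G -> (forall z, 0 <= G z) ->
  joint_bound m1 m2 G n A ->
  joint_bound m2 m1 (fun w => G (w.2, w.1)) n A.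
Proof.
move=> mG G0 HA F mF F0.
have mF' : measurable_fun setT (fun z : T1 * T2 => F (z.2, z.1)).
  have ms : measurable_fun setT (fun z : T1 * T2 => (z.2, z.1)).
    exact: measurable_swap.
  exact: (measurableT_comp mF ms).
have := HA _ mF' (fun z => F0 (z.2, z.1)).
rewrite integral_prod_swap; last 2 first.
- by apply/measurable_EFinP/measurable_funM.
- by move=> z; rewrite lee_fin mulr_ge0.
rewrite (@integral_prod_swap _ _ _ _ _ m1 m2
  (fun z => (F (z.2, z.1) `^ n)%:E)); last 2 first.
- exact/measurable_EFinP/measurable_fun_powR.
- by move=> z; rewrite lee_fin powR_ge0.
have swapE (H : T2 * T1 -> \bar R) :
    (\int[m2 \x m1]_w H (w.1, w.2) = \int[m2 \x m1]_w H w)%E.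
  by apply: eq_integral => -[].
rewrite /= (swapE (fun w => (F w * G (w.2, w.1))%:E)).
by rewrite (swapE (fun w => (F w `^ n)%:E)).
Qed.

(** * Constants and the interpolation between the endpoint estimates *)

Section constants.
Context (R : realType).

(** What remains of N (lambda min(1, lambda)^c)^e at lambda = r^-2 once the power
    of r is split off, uniformly for r at most Rbar. The maximum with 1 makes the
    factor at least 1 when c >= 0 >= e, so that any power of it with exponent in
    [0, 1] is at most the factor itself. *)
Definition green_factor (N c e Rbar : R) : R :=
  Num.max 1 N * Num.min 1 (Rbar ^- 2) `^ (c * e).

Lemma green_factor_ge1 (N c e Rbar : R) : 0 < Rbar -> 0 <= c -> e <= 0 ->
  1 <= green_factor N c e Rbar.
Proof.
move=> R0 c0 e0; rewrite /green_factor -[leLHS]mulr1 ler_pM ?le_max ?lexx//.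
set u := Num.min _ _; have u0 : 0 < u by rewrite lt_min ltr01 invr_gt0 exprn_gt0.
have u1 : u <= 1 by rewrite ge_min lexx.
rewrite -[c * e]opprK powRN invf_ge1 ?powR_gt0//.
apply: (@le_trans _ _ (1 `^ (- (c * e)))); last by rewrite powR1.
apply: ge0_ler_powR; rewrite ?nnegrE ?(ltW u0)//.
by rewrite oppr_ge0 mulr_ge0_le0.
Qed.

(** As c e <= 0, the power min(1, r^-2)^(c e) is largest at r = Rbar. *)
Lemma green_factorP (N c e r Rbar : R) : 0 < r <= Rbar -> 0 <= c -> e <= 0 ->
  N * (r ^- 2 * Num.min 1 (r ^- 2) `^ c) `^ e <=
  green_factor N c e Rbar * r `^ (- 2 * e).
Proof.
move=> /andP[r0 rR] c0 e0; have R0 : 0 < Rbar by exact: lt_le_trans rR.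
set v := Num.min 1 (r ^- 2).
have v0 : 0 < v by rewrite lt_min ltr01 invr_gt0 exprn_gt0.
set u := Num.min 1 (Rbar ^- 2).
have u0 : 0 < u by rewrite lt_min ltr01 invr_gt0 exprn_gt0.
have uv : u <= v.
  rewrite le_min ge_min lexx /= ge_min; apply/orP; right.
  by rewrite lef_pV2 ?posrE ?exprn_gt0// lerXn2r ?nnegrE ?(ltW r0) ?(ltW R0).
rewrite powRM ?powR_ge0 ?invr_ge0 ?exprn_ge0 ?(ltW r0)// -powRrM.
rewrite (_ : (r ^- 2) `^ e = r `^ (- 2 * e)); last first.
  by rewrite powRrM powRN powR_mulrn ?ltW.
rewrite mulrCA mulrC ler_wpM2r ?powR_ge0// /green_factor -/u.
apply: (@le_trans _ _ (Num.max 1 N * v `^ (c * e))).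
  by rewrite ler_wpM2r ?powR_ge0// le_max lexx orbT.
rewrite ler_wpM2l ?le_max ?ler01//.
have ce0 : 0 <= - (c * e) by rewrite oppr_ge0 mulr_ge0_le0.
rewrite -[c * e]opprK !(powRN _ (- _)) lef_pV2 ?posrE ?powR_gt0//.
by apply: ge0_ler_powR; rewrite ?nnegrE ?(ltW u0) ?(ltW v0).
Qed.

Lemma interpolated_constant (M1 M2 r a b th : R) :
  1 <= M1 -> 1 <= M2 -> 0 < r -> 0 <= th <= 1 ->
  (M1 * r `^ a) `^ th * (M2 * r `^ b) `^ (1 - th) <=
  M1 * M2 * r `^ (a * th + b * (1 - th)).
Proof.
move=> M11 M21 r0 /andP[th0 th1].
have M10 : 0 <= M1 by exact: le_trans M11.
have M20 : 0 <= M2 by exact: le_trans M21.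
have powM M t : 1 <= M -> t <= 1 -> M `^ t <= M.
  move=> M1' t1; rewrite -[leRHS]powRr1 ?(le_trans ler01)//.
  exact: ler_powR.
rewrite !powRM ?powR_ge0// -!powRrM mulrACA.
rewrite -powRD ?(gt_eqF r0) ?implybT//.
rewrite ler_wpM2r ?powR_ge0// ler_pM ?powR_ge0 ?powM//.
by rewrite gerBl.
Qed.

End constants.

Section mixed_norm_bound.
Context (R : realType) (d : nat).

Local Notation leb := (@lebesgue_measure R).
Local Notation vol := (lebesgue_vec R d).

(** If q <= p then p >= d0 + 1, the inner variable is the position, and the bound
    interpolates towards the time marginal (m = 1); if p < q then q > d0 + 1, the
    inner variable is time, and it interpolates towards the space marginal
    (m = d0). The constants interpolate to the same power of r in both ranges
    because k / (d0 + 1), k / d0 and 0 are the values of k / p at the three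
    extreme pairs. *)
Lemma mixed_norm_bound (Q : set (R * 'cV[R]_d)) (G f : R * 'cV[R]_d -> R)
    (d0 k M1 M2 r : R) (p q : \bar R) :
  measurable_fun setT G -> (forall z, 0 <= G z) ->
  1 < d0 -> 0 < r -> 1 <= M1 -> 1 <= M2 ->
  joint_bound leb vol G (d0 + 1) (M1 * r `^ (k / (d0 + 1))) ->
  marginal_bound leb vol G 1 1 ->
  marginal_bound vol leb (fun w => G (w.2, w.1)) d0 (M2 * r `^ (k / d0)) ->
  (1 <= p)%E -> (1 <= q)%E -> (d0%:E * p^-1 + q^-1 = 1)%E ->
  measurable_fun setT (extend0 Q f) -> (forall z, 0 <= extend0 Q f z) ->
  (\int[leb \x vol]_z (extend0 Q f z * G z)%:E <=
   (M1 * M2 * r `^ (k * fine p^-1))%:E * mixed_norm p q Q f)%E.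
Proof.
move=> mG G0 d01 r0 M11 M21 HJ Ht Hx p1 q1 pq mf f0.
have d00 : 0 < d0 by exact: lt_trans d01.
have n0 : 0 < d0 + 1 by rewrite addr_gt0.
have M10 : 0 < M1 by exact: lt_le_trans M11.
have M20 : 0 < M2 by exact: lt_le_trans M21.
have A10 : 0 < M1 * r `^ (k / (d0 + 1)) by rewrite mulr_gt0 ?powR_gt0.
have A20 : 0 < M2 * r `^ (k / d0) by rewrite mulr_gt0 ?powR_gt0.
have M121 : 1 <= M1 * M2 by rewrite -[leLHS]mulr1 ler_pM.
have ms : measurable_fun setT (fun w : 'cV[R]_d * R => (w.2, w.1)).
  exact: measurable_swap.
have mGs := measurableT_comp mG ms.
have mfs := measurableT_comp mf ms.
have HJs := @joint_bound_swap _ _ _ _ _ leb vol _ _ _ mG G0 HJ.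
have swapE : (\int[leb \x vol]_z (extend0 Q f z * G z)%:E =
    \int[vol \x leb]_w (extend0 Q f (w.2, w.1) * G (w.2, w.1))%:E)%E.
  rewrite (@integral_prod_swap _ _ _ _ _ leb vol
    (fun z => (extend0 Q f z * G z)%:E))//.
  - by apply/measurable_EFinP/measurable_funM.
  - by move=> z; rewrite lee_fin mulr_ge0.
have widen (c c' : R) (Y : \bar R) : c <= c' -> (0 <= Y)%E ->
    (c%:E * Y <= c'%:E * Y)%E.
  by move=> cc' Y0; apply: lee_wpmul2r => //; rewrite lee_fin.
rewrite /mixed_norm.
case: p p1 pq => [p||//].
- rewrite lee_fin => p1; have p0 : 0 < p by exact: lt_le_trans p1.
  rewrite inver gt_eqF//= -EFinM.
  case: q q1 => [q||//].
  + rewrite lee_fin => q1; have q0 : 0 < q by exact: lt_le_trans q1.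
    rewrite inver gt_eqF// -EFinD => -[pq].
    have pqE : p * q = d0 * q + p.
      have := congr1 (fun t => t * (p * q)) pq => /=.
      rewrite mul1r => <-; field; rewrite ?gt_eqF//.
    rewrite lee_fin; case: ifPn => [qp|].
    * have np : d0 + 1 <= p by nra.
      move: np; rewrite le_eqVlt => /predU1P[np|np].
        have qE : q = p by subst p; nra.
        rewrite qE -np.
        apply: (le_trans (@diagonal_mixed_bound _ _ _ _ _ leb vol _ _ _ _
          n0 HJ mf f0)).
        apply: widen; last exact: Lnorm_ge0.
        by rewrite ler_wpM2r ?powR_ge0// ler_peMr// ltW.
      have n0p : 0 < d0 + 1 < p by rewrite n0.
      have pqm : (p - q) * 1 = q * (p - (d0 + 1)) by lra.
      apply: (le_trans (@weighted_mixed_bound _ _ _ _ _ leb vol _ mG G0 _ _ _ _ _ _ _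
        n0p ltr01 q0 pqm A10 ltr01 HJ Ht mf f0)).
      apply: widen; last exact: Lnorm_ge0.
      have th01 : 0 <= (d0 + 1) / p <= 1.
        by rewrite divr_ge0 ?(ltW n0) ?(ltW p0)//= ler_pdivrMr// mul1r ltW.
      (* The time marginal has norm 1, so its constant is 1 * r ^ 0. *)
      have := interpolated_constant (k / (d0 + 1)) 0 M11 (lexx 1) r0 th01.
      rewrite powRr0 !mulr1 powR1 mulr1 mul0r addr0 => /le_trans; apply.
      rewrite (_ : k / (d0 + 1) * ((d0 + 1) / p) = k * p^-1); last first.
        by field; rewrite ?gt_eqF.
      by rewrite ler_wpM2r ?powR_ge0// ler_peMr// ltW.
    * rewrite -ltNge => ltpq.
      have nq : d0 + 1 < q by nra.
      have n0q : 0 < d0 + 1 < q by rewrite n0.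
      have pqm : (q - p) * d0 = p * (q - (d0 + 1)) by lra.
      rewrite swapE.
      apply: (le_trans (@weighted_mixed_bound _ _ _ _ _ vol leb _ mGs
        (fun w => G0 (w.2, w.1)) _ _ _ _ _ _ _
        n0q d00 p0 pqm A10 A20 HJs Hx mfs (fun w => f0 (w.2, w.1)))).
      apply: widen; last exact: Lnorm_ge0.
      have th01 : 0 <= (d0 + 1) / q <= 1.
        by rewrite divr_ge0 ?(ltW n0) ?(ltW q0)//= ler_pdivrMr// mul1r ltW.
      apply: (le_trans (interpolated_constant _ _ M11 M21 r0 th01)).
      have pinv : p^-1 = (1 - q^-1) / d0.
        by rewrite -pq addrK mulrAC divff ?mul1r// gt_eqF.
      rewrite (_ : _ + _ = k * p^-1)// pinv.
      by field; rewrite ?gt_eqF.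
  + move=> _; rewrite invey adde0 => -[pq].
    have {}pq : d0 = p by rewrite -[RHS]mul1r -pq divfK// gt_eqF.
    rewrite leye_eq /= swapE.
    apply: (le_trans (@endpoint_mixed_bound _ _ _ _ _ vol leb _ mGs
      (fun w => G0 (w.2, w.1)) _ _ _ d00 A20 Hx mfs (fun w => f0 (w.2, w.1)))).
    rewrite -pq; apply: widen; last exact: Lnorm_ge0.
    by rewrite ler_wpM2r ?powR_ge0// ler_peMl// ltW.
- rewrite invey mule0 add0e => _ /eqP; rewrite inve_eq1 => /eqP ->.
  rewrite leey /= mulr0 powRr0 mulr1.
  apply: (le_trans (@endpoint_mixed_bound _ _ _ _ _ leb vol _ mG G0 _ _ _
    ltr01 ltr01 Ht mf f0)).
  by apply: widen; last exact: Lnorm_ge0.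
Qed.

End mixed_norm_bound.

(** * The occupation estimate in mixed norms *)

Theorem theorem4p10 (R : realType) (xibar : nat -> R -> R)
    (Nbar : nat -> R -> R -> R) (d0 : R -> nat -> R -> R -> R) :
  exit_constants xibar Nbar ->
  green_exponent Nbar d0 ->
  exists N : R -> nat -> R -> \bar R -> R -> R -> R -> R,
  forall (d : nat) (delta p0 q0 Rlow : R), admissible d delta p0 q0 ->
  0 < Rlow ->
  forall (Rbar : R) (p q : \bar R), 0 < Rbar ->
  (1 <= p)%E -> (1 <= q)%E ->
  ((d0 delta d Rlow p0)%:E * p^-1 + q^-1 = 1)%E ->
  forall (X : ito_process d delta) (h : R * 'cV[R]_d -> R) (bbar : R -> R),
  morrey_drift X p0 q0 h bbar ->
  Nbar d p0 delta * bbar Rlow < 1 ->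
  forall (r : R) (x : 'cV[R]_d) (f : R * 'cV[R]_d -> R),
  0 < r <= Rbar ->
  measurable_fun (cylinder (r ^+ 2) r) f ->
  (forall z, cylinder (r ^+ 2) r z -> 0 <= f z) ->
  (expect_int (tau X r x) (fun t omega => f (t, (x + ip_path t omega)%R))
   <= (N delta d Rlow p p0 (bbar Rbar) Rbar
       * r `^ ((2 * d0 delta d Rlow p0 - d%:R) * fine (p^-1)%E))%:E
      * mixed_norm p q (cylinder (r ^+ 2) r) f)%E.
Proof.
move=> _ [NG [Ng green]].
pose M1 delta d Rlow p0 Rbar := green_factor
  (NG delta d Rlow p0 (d0 delta d Rlow p0 + 1))
  (d%:R / (2 * (d0 delta d Rlow p0 + 1) - d%:R - 2))
  ((d%:R + 2) / (2 * (d0 delta d Rlow p0 + 1)) - 1) Rbar.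
pose M2 delta d Rlow p0 Rbar := green_factor
  (Ng delta d Rlow p0 (d0 delta d Rlow p0))
  (d%:R / (2 * d0 delta d Rlow p0 - d%:R))
  (d%:R / (2 * d0 delta d Rlow p0) - 1) Rbar.
exists (fun delta d Rlow _ p0 _ Rbar =>
  expR 1 * (M1 delta d Rlow p0 Rbar * M2 delta d Rlow p0 Rbar)).
move=> d delta p0 q0 Rlow adm Rlow0 Rbar p q Rbar0 p1 q1 pq X h bbar mor NR.
move=> r x f rR mf f0.
have [/andP[]] := green d delta p0 q0 Rlow adm Rlow0.
rewrite /M1 /M2; set e := d0 delta d Rlow p0 in pq * => e1 ed de bounds.
have r0 : 0 < r by case/andP: rR.
have lam0 : 0 < r ^- 2 by rewrite invr_gt0 exprn_gt0.
(* With lambda = r^-2 the discount stays above 1/e during the time span r^2. *)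
have [[G GG] [g gg] /(_ G GG (e + 1) (lexx _)) HG /(_ g gg e (lexx _)) Hg] :=
  bounds X h bbar mor NR _ lam0.
set D : R := d%:R in de HG Hg *.
have D0 : 0 <= D by exact: ler0n.
have e0 : 0 < e by exact: lt_trans e1.
have n0 : 0 < e + 1 by rewrite addr_gt0.
have De : 0 < 2 * e - D by lra.
have c1 : 0 <= D / (2 * (e + 1) - D - 2) by rewrite divr_ge0//; lra.
have c2 : 0 <= D / (2 * e - D) by rewrite divr_ge0// ltW.
have s1 : (D + 2) / (2 * (e + 1)) - 1 <= 0.
  by rewrite subr_le0 ler_pdivrMr ?mulr_gt0//; lra.
have s2 : D / (2 * e) - 1 <= 0.
  by rewrite subr_le0 ler_pdivrMr ?mulr_gt0//; lra.
set m1 := green_factor _ _ _ Rbar; set m2 := green_factor _ _ _ Rbar.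
have m11 : 1 <= m1 by exact: green_factor_ge1.
have m21 : 1 <= m2 by exact: green_factor_ge1.
have := green_factorP (NG delta d Rlow p0 (e + 1)) rR c1 s1.
rewrite -lee_fin => /(le_trans HG) HG'.
have := green_factorP (Ng delta d Rlow p0 e) rR c2 s2.
rewrite -lee_fin => /(le_trans Hg) Hg'.
rewrite -/m1 (_ : - 2 * _ = (2 * e - D) / (e + 1)) in HG'; last first.
  by field; rewrite gt_eqF.
rewrite -/m2 (_ : - 2 * _ = (2 * e - D) / e) in Hg'; last first.
  by field; rewrite gt_eqF.
have mC := @measurable_cylinder R d (r ^+ 2) r r0.
have mfC : measurable_fun setT (extend0 (cylinder (r ^+ 2) r) f).
  exact/(measurable_restrictT f mC).
have fC0 z : 0 <= extend0 (cylinder (r ^+ 2) r) f z.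
  by rewrite /extend0; case: ifPn => //; rewrite inE => /f0.
have mGs := measurable_shifted_green GG x.
have Gs0 := shifted_green_ge0 GG x.
have en1 : 1 < e + 1 by rewrite ltrDr.
have HJ := joint_bound_green GG x en1 HG'.
have Ht := marginal_bound_time lam0 GG x.
have Hx := marginal_bound_space GG gg x e1 Hg'.
apply: (le_trans (expect_int_le_green x r0 GG mf f0)).
have mefC : measurable_fun setT
    (fun z => expR 1 * extend0 (cylinder (r ^+ 2) r) f z).
  exact: measurable_funM.
rewrite -(integral_shifted_green GG x mefC); last first.
  by move=> z; rewrite mulr_ge0 ?expR_ge0.
under eq_integral do rewrite -mulrA EFinM.
rewrite ge0_integralZl_EFin ?expR_ge0//; last 2 first.
- by move=> z _; rewrite lee_fin mulr_ge0.
- exact/measurable_EFinP/measurable_funM.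
rewrite -[_ * _ * r `^ _]mulrA EFinM -muleA; apply: lee_wpmul2l.
  by rewrite lee_fin expR_ge0.
exact: (mixed_norm_bound mGs Gs0 e1 r0 m11 m21 HJ Ht Hx p1 q1 pq mfC fC0).
Qed.
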